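(* Let $t\ge2$ be an integer, let $(m_1,k_1)$ and $(m_2,k_2)$ be admissible parameters with $m_1/k_1<m_2/k_2$ that are Farey-adjacent, i.e. $m_2k_1-m_1k_2=1$, and put $(m,k)=(m_1+m_2,\,k_1+k_2)$, $n=tk=t(k_1+k_2)$. Then the lower path of $(m,k)$ (with respect to $t$) coincides, vertex by vertex, with the path obtained by concatenating, starting from the origin, the following unit edges in this order: (i) the edges $j=0,\dots,k_1-1$ of the lower path of $(m_1,k_1)$ (with respect to $t$), edge $j$ being rotated by the angle $+\,j\cdot\frac{2\pi}{k_1n}$; (ii) the edges $i=0,\dots,k_2-1$ of the lower path of $(m_2,k_2)$ (with respect to $t$), edge $i$ being rotated by the angle $+\frac{2\pi}{n}-i\cdot\frac{2\pi}{k_2n}$; (iii) the terminal edge, of direction angle $2\pi/t$, which is the same vector for the three parameters $(m_1,k_1)$, $(m_2,k_2)$, $(m,k)$. In particular all edges keep unit length; only their directions change, by an angle that is affine in the edge number within each of the two blocks.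
   Context: An admissible parameter is a pair of integers $(m,k)$ that either satisfies $0<m<k$ and $\gcd(m,k)=1$, or is one of the two formal seeds $(0,1)$, $(1,1)$. Fix an integer $t\ge2$. For an admissible $(m,k)$ put $n=tk$, $v_n(d)=(\cos\frac{2\pi d}{n},\sin\frac{2\pi d}{n})\in\mathbb{R}^2$, and $s_j=jm\bmod k\in\{0,\dots,k-1\}$ for $0\le j\le k-1$. The lower word is $\ell=(\ell_0,\dots,\ell_k)=(s_0,\dots,s_{k-1},k)$. The lower path of $(m,k)$ is the polygonal path starting at the origin and successively appending the unit edges $v_n(\ell_0),\dots,v_n(\ell_k)$; thus edge $j$ ($0\le j\le k-1$) has direction angle $2\pi s_j/(tk)$, and the last edge, called the terminal edge, has direction angle $2\pi/t$. (The lower path is the lower boundary path of the $(m,k)$-prototile of the Modulo Krinkle family, whose upper boundary path is built in the same way from the word obtained from $\ell$ by exchanging its first and last entries.) Rotation of an edge by an angle means rotation of its edge vector (counterclockwise if positive); the rotated vectors are then concatenated head to tail. The $n$ appearing in the rotation angles is that of the child, $n=t(k_1+k_2)$. *)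

(* Defs.v *)
From mathcomp Require Import all_boot all_order all_algebra.
From mathcomp Require Import all_classical all_reals all_analysis.

Set Implicit Arguments.
Unset Strict Implicit.
Unset Printing Implicit Defensive.

Import Order.TTheory GRing.Theory Num.Theory.

Local Open Scope ring_scope.

(* Admissible pairs have nonnegative entries, so both components are nat. *)
Definition admissible (m k : nat) : Prop :=
  ((0 < m < k)%N /\ coprime m k) \/ (m, k) = (0%N, 1%N) \/ (m, k) = (1%N, 1%N).

Definition unit_vec (R : realType) (n d : nat) : R * R :=
  (cos (2 * pi * d%:R / n%:R), sin (2 * pi * d%:R / n%:R)).

Definition lower_word (m k : nat) : seq nat :=
  rcons [seq ((j * m) %% k)%N | j <- iota 0 k] k.

Definition lower_edges (R : realType) (t m k : nat) : seq (R * R) :=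
  [seq unit_vec R (t * k) d | d <- lower_word m k].

Definition lower_edge (R : realType) (t m k j : nat) : R * R :=
  nth 0 (lower_edges R t m k) j.

Definition terminal_edge (R : realType) (t m k : nat) : R * R :=
  lower_edge R t m k k.

(* The list of all vertices, including the starting point 0. *)
Definition polygonal_path (R : realType) (es : seq (R * R)) : seq (R * R) :=
  0 :: scanl +%R 0 es.

Definition lower_path (R : realType) (t m k : nat) : seq (R * R) :=
  polygonal_path (lower_edges R t m k).

Definition rotate (R : realType) (a : R) (u : R * R) : R * R :=
  (cos a * u.1 - sin a * u.2, sin a * u.1 + cos a * u.2).

(* The library norm on R * R is the sup norm, hence this Euclidean length. *)
Definition edge_length (R : realType) (u : R * R) : R :=
  Num.sqrt (u.1 ^+ 2 + u.2 ^+ 2).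

Definition first_block (R : realType) (t m1 k1 n : nat) : seq (R * R) :=
  [seq rotate (j%:R * (2 * pi / (k1%:R * n%:R))) (lower_edge R t m1 k1 j)
     | j <- iota 0 k1].

Definition second_block (R : realType) (t m2 k2 n : nat) : seq (R * R) :=
  [seq rotate (2 * pi / n%:R - i%:R * (2 * pi / (k2%:R * n%:R)))
         (lower_edge R t m2 k2 i)
     | i <- iota 0 k2].

(* Main.v *)
Require Import Defs.
From mathcomp Require Import all_boot all_order all_algebra.
From mathcomp Require Import all_classical all_reals all_analysis.
From mathcomp Require Import zify ring.

Import Order.TTheory GRing.Theory Num.Theory.

Local Open Scope ring_scope.

(** Write [m = m1 + m2] and [k = k1 + k2].  The mediant of two Farey
    neighbours satisfies [m / k = m1 / k1 + 1 / (k1 * k)] and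
    [m / k = m2 / k2 - 1 / (k2 * k)].  Hence replacing [m1 / k1] by [m / k]
    moves [j * m1 / k1] up by [j / (k1 * k)]; for [j < k1] this is too little
    to reach the next integer, so the fractional parts differ by exactly that
    amount.  Since the direction of edge [j] is [2 * pi / t] times the
    fractional part of [j * m / k], this is the rotation of the first block.
    In the second block the edge number is [k1 + i], and [k1 * m = 1] modulo
    [k] contributes the constant [1 / k], from which [i / (k2 * k)] is
    subtracted; again no integer is crossed.

    The two comparisons of fractional parts, cleared of denominators, are the
    identities between natural numbers [mediant_mod_left] and
    [mediant_mod_right].  They make the edges of the child equal, as vectors,
    to the rotated edges of the parents, so the paths agree vertex by vertex;
    and since the rotated edges are edges of a lower path, they are unit
    vectors. *)

(** * Residues along the mediant *)

(** As [m1 * k + 1 = m * k1], the number [j * m * k1] is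
    [j * m1 * k + j]; dividing [j * m1] by [k1] leaves the remainder
    [k * (j * m1 %% k1) + j] modulo [k * k1], which is already reduced
    because [j < k1 <= k]. *)
Lemma mediant_mod_left (m1 k1 m2 k2 j : nat) :
  (m2 * k1 = m1 * k2 + 1)%N -> (j < k1)%N ->
  ((j * (m1 + m2)) %% (k1 + k2) * k1 = (k1 + k2) * ((j * m1) %% k1) + j)%N.
Proof.
move=> adj ltj.
have k1_gt0 : (0 < k1)%N by exact: leq_ltn_trans ltj.
have ltr : ((j * m1) %% k1 < k1)%N by rewrite ltn_mod.
have := divn_eq (j * m1) k1.
move: ltr; set r := (_ %% k1)%N; set q := (_ %/ k1)%N => ltr Eq.
rewrite muln_modl.
have -> : (j * (m1 + m2) * k1
           = q * ((k1 + k2) * k1) + ((k1 + k2) * r + j))%N.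
  have -> : (j * (m1 + m2) * k1 = j * m1 * (k1 + k2) + j)%N by nia.
  by rewrite Eq; ring.
by rewrite modnMDl modn_small //; nia.
Qed.

(** Here [k1 * m = m1 * k + 1] and [m * k2 + 1 = m2 * k], so
    [(k1 + i) * m * k2] is [k2 - i] more than a multiple of [k].
    The remainder [k * r + (k2 - i)] with [r < k2] stays below [k * k2]
    because [k2 < k]. *)
Lemma mediant_mod_right (m1 k1 m2 k2 i : nat) :
  (m2 * k1 = m1 * k2 + 1)%N -> (i < k2)%N ->
  (((k1 + i) * (m1 + m2)) %% (k1 + k2) * k2
   = (k1 + k2) * ((i * m2) %% k2) + (k2 - i))%N.
Proof.
move=> adj lti.
have k2_gt0 : (0 < k2)%N by exact: leq_ltn_trans lti.
have k1_gt0 : (0 < k1)%N by case: k1 adj => //; rewrite muln0 addn1.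
have ltr : ((i * m2) %% k2 < k2)%N by rewrite ltn_mod.
have := divn_eq (i * m2) k2.
move: ltr; set r := (_ %% k2)%N; set q := (_ %/ k2)%N => ltr Eq.
rewrite muln_modl.
have -> : ((k1 + i) * (m1 + m2) * k2
           = (m1 + q) * ((k1 + k2) * k2) + ((k1 + k2) * r + (k2 - i)))%N.
  have -> : ((m1 + q) * ((k1 + k2) * k2) + ((k1 + k2) * r + (k2 - i))
             = m1 * (k1 + k2) * k2 + (q * k2 + r) * (k1 + k2) + (k2 - i))%N.
    by ring.
  rewrite -Eq.
  have Ek1 : (k1 * (m1 + m2) = m1 * (k1 + k2) + 1)%N by nia.
  have Ei : (i * (m1 + m2) * k2 + i = i * m2 * (k1 + k2))%N by nia.
  by rewrite mulnDl mulnDl Ek1; lia.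
by rewrite modnMDl modn_small //; nia.
Qed.

Lemma admissible_bounds (m k : nat) : admissible m k -> (m <= k)%N /\ (0 < k)%N.
Proof.
by case=> [[/andP[m_gt0 ltmk] _]|[[-> ->]|[-> ->]]] //; split; lia.
Qed.

(** Coprimality comes from the relation [m * k1 - k * m1 = 1], which the
    mediant inherits. *)
Lemma admissible_mediant (m1 k1 m2 k2 : nat) :
  admissible m1 k1 -> admissible m2 k2 -> (m2 * k1 = m1 * k2 + 1)%N ->
  admissible (m1 + m2) (k1 + k2).
Proof.
move=> /admissible_bounds[le1 k1_gt0] /admissible_bounds[le2 k2_gt0] adj.
left; split; first by apply/andP; split; nia.
rewrite /coprime -dvdn1 -(@dvdn_addr ((k1 + k2) * m1)); last first.
  exact/dvdn_mulr/dvdn_gcdr.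
have -> : ((k1 + k2) * m1 + 1 = (m1 + m2) * k1)%N by nia.
exact/dvdn_mulr/dvdn_gcdl.
Qed.

(** * Edges as unit vectors *)

Lemma lower_edgeE (R : realType) (t m k j : nat) : (j < k)%N ->
  lower_edge R t m k j = unit_vec R (t * k) ((j * m) %% k).
Proof.
move=> ltj; rewrite /lower_edge /lower_edges /lower_word map_rcons nth_rcons.
rewrite !size_map size_iota ltj -map_comp (nth_map 0%N) ?size_iota //=.
by rewrite nth_iota.
Qed.

Lemma terminal_edgeE (R : realType) (t m k : nat) : (0 < k)%N ->
  terminal_edge R t m k = (cos (2 * pi / t%:R), sin (2 * pi / t%:R)).
Proof.
move=> k_gt0.
rewrite /terminal_edge /lower_edge /lower_edges /lower_word map_rcons nth_rcons.
rewrite !size_map size_iota ltnn eqxx /unit_vec natrM -mulf_div divff ?mulr1 //.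
by rewrite pnatr_eq0 -lt0n.
Qed.

Lemma lower_edges_rcons (R : realType) (t m k : nat) :
  lower_edges R t m k =
  rcons [seq lower_edge R t m k j | j <- iota 0 k] (terminal_edge R t m k).
Proof.
have sz : size (lower_edges R t m k) = k.+1.
  by rewrite size_map size_rcons size_map size_iota.
by rewrite -cats1 -[in LHS](mkseq_nth 0 (lower_edges R t m k)) sz /mkseq
  -addn1 iotaD map_cat.
Qed.

Lemma edge_length_unit_vec (R : realType) (n d : nat) :
  edge_length (unit_vec R n d) = 1.
Proof. by rewrite /edge_length /= cos2Dsin2 sqrtr1. Qed.

Lemma lower_edges_length (R : realType) (t m k : nat) (u : R * R) :
  u \in lower_edges R t m k -> edge_length u = 1.
Proof. by case/mapP=> d _ ->; exact: edge_length_unit_vec. Qed.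

Lemma rotate_unit_vec (R : realType) (a : R) (n n' d d' : nat) :
  a + 2 * pi * d%:R / n%:R = 2 * pi * d'%:R / n'%:R ->
  rotate a (unit_vec R n d) = unit_vec R n' d'.
Proof. by rewrite /rotate /unit_vec /= => <-; rewrite cosD sinD [X in (_, X)]addrC. Qed.

(** * Edges of the mediant path *)

Lemma lower_edge_mediant_left (R : realType) (t m1 k1 m2 k2 j : nat) :
  (0 < t)%N -> (m2 * k1 = m1 * k2 + 1)%N -> (j < k1)%N ->
  lower_edge R t (m1 + m2) (k1 + k2) j =
  rotate (j%:R * (2 * pi / (k1%:R * (t * (k1 + k2))%:R)))
         (lower_edge R t m1 k1 j).
Proof.
move=> t_gt0 adj ltj; rewrite !lower_edgeE ?ltn_addr //.
apply/esym/rotate_unit_vec.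
have := congr1 (fun x : nat => x%:R : R) (mediant_mod_left _ _ _ _ _ adj ltj).
set s := (_ %% (k1 + k2))%N; set r := (_ %% k1)%N.
rewrite !natrM natrD natrM => E.
have t_neq0 : t%:R != 0 :> R by rewrite pnatr_eq0 -lt0n.
have k1_neq0 : k1%:R != 0 :> R by rewrite pnatr_eq0; lia.
have k_neq0 : (k1 + k2)%:R != 0 :> R by rewrite pnatr_eq0; lia.
have -> : s%:R = ((k1 + k2)%:R * r%:R + j%:R) / k1%:R :> R.
  by rewrite -E mulfK.
by field; rewrite -?natrD t_neq0 k1_neq0 k_neq0.
Qed.

Lemma lower_edge_mediant_right (R : realType) (t m1 k1 m2 k2 i : nat) :
  (0 < t)%N -> (m2 * k1 = m1 * k2 + 1)%N -> (i < k2)%N ->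
  lower_edge R t (m1 + m2) (k1 + k2) (k1 + i) =
  rotate (2 * pi / (t * (k1 + k2))%:R
          - i%:R * (2 * pi / (k2%:R * (t * (k1 + k2))%:R)))
         (lower_edge R t m2 k2 i).
Proof.
move=> t_gt0 adj lti; rewrite !lower_edgeE ?ltn_add2l //.
apply/esym/rotate_unit_vec.
have := congr1 (fun x : nat => x%:R : R) (mediant_mod_right _ _ _ _ _ adj lti).
set s := (_ %% (k1 + k2))%N; set r := (_ %% k2)%N.
rewrite !natrM natrD natrM natrB 1?ltnW // => E.
have t_neq0 : t%:R != 0 :> R by rewrite pnatr_eq0 -lt0n.
have k2_neq0 : k2%:R != 0 :> R by rewrite pnatr_eq0; lia.
have k_neq0 : (k1 + k2)%:R != 0 :> R by rewrite pnatr_eq0; lia.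
have -> : s%:R = ((k1 + k2)%:R * r%:R + (k2%:R - i%:R)) / k2%:R :> R.
  by rewrite -E mulfK.
by field; rewrite -?natrD t_neq0 k2_neq0 k_neq0.
Qed.

Lemma lower_edges_mediant (R : realType) (t m1 k1 m2 k2 : nat) :
  (0 < t)%N -> (m2 * k1 = m1 * k2 + 1)%N ->
  lower_edges R t (m1 + m2) (k1 + k2) =
  first_block R t m1 k1 (t * (k1 + k2))
  ++ second_block R t m2 k2 (t * (k1 + k2))
  ++ [:: terminal_edge R t (m1 + m2) (k1 + k2)].
Proof.
move=> t_gt0 adj.
rewrite lower_edges_rcons -cats1 iotaD map_cat -catA; congr (_ ++ (_ ++ _)).
  apply/eq_in_map => j; rewrite mem_iota => /andP[_ ltj].
  exact: lower_edge_mediant_left.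
rewrite add0n -[X in iota X k2](addn0 k1) iotaDl -map_comp.
apply/eq_in_map => i; rewrite mem_iota => /andP[_ lti].
exact: lower_edge_mediant_right.
Qed.

Theorem theorem4p1 (R : realType) (t m1 k1 m2 k2 : nat)
  (ht : (2 <= t)%N)
  (h1 : admissible m1 k1) (h2 : admissible m2 k2)
  (hlt : m1%:R / k1%:R < m2%:R / k2%:R :> rat)
  (hadj : m2%:Z * k1%:Z - m1%:Z * k2%:Z = 1) :
  let m := (m1 + m2)%N in
  let k := (k1 + k2)%N in
  let n := (t * k)%N in
  let e : R * R := (cos (2 * pi / t%:R), sin (2 * pi / t%:R)) in
  let new_edges := first_block R t m1 k1 n ++ second_block R t m2 k2 n ++ [:: e] in
  [/\ admissible m k,
      lower_path R t m k = polygonal_path new_edges,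
      [/\ terminal_edge R t m1 k1 = e,
          terminal_edge R t m2 k2 = e &
          terminal_edge R t m k = e],
      (forall u : R * R,
         u \in lower_edges R t m1 k1 ++ lower_edges R t m2 k2 ++ new_edges ->
         edge_length u = 1) &
      (exists a b : R, forall j : nat, (j < k1)%N ->
         lower_edge R t m k j = rotate (a + b * j%:R) (lower_edge R t m1 k1 j)) /\
      (exists a b : R, forall i : nat, (i < k2)%N ->
         lower_edge R t m k (k1 + i) =
         rotate (a + b * i%:R) (lower_edge R t m2 k2 i))].
Proof.
move=> m k n e new_edges.
have t_gt0 : (0 < t)%N by exact: ltnW.
have adj : (m2 * k1 = m1 * k2 + 1)%N by lia.
have [_ k1_gt0] := admissible_bounds _ _ h1.
have [_ k2_gt0] := admissible_bounds _ _ h2.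
have k_gt0 : (0 < k)%N by rewrite addn_gt0 k1_gt0.
have Enew : lower_edges R t m k = new_edges.
  by rewrite lower_edges_mediant // terminal_edgeE.
split.
- exact: admissible_mediant.
- by rewrite /lower_path Enew.
- by split; exact: terminal_edgeE.
- by move=> u; rewrite -Enew !mem_cat => /or3P[] /lower_edges_length.
- split.
    exists 0, (2 * pi / (k1%:R * n%:R)) => j ltj.
    by rewrite add0r [_ * j%:R]mulrC; exact: lower_edge_mediant_left.
  exists (2 * pi / n%:R), (- (2 * pi / (k2%:R * n%:R))) => i lti.
  by rewrite mulNr [_ * i%:R]mulrC; exact: lower_edge_mediant_right.
Qed.
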